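(* There are, up to isomorphism, exactly two cubic graphs of order $6$, namely the complete bipartite graph $K_{3,3}$ and the triangular prism $K_3\,\square\,K_2$, and both have coalition number $6$: $C(K_{3,3})=C(K_3\,\square\,K_2)=6$.
   Context: All graphs are finite and simple; a cubic graph is a $3$-regular graph (not necessarily connected), and the order of a graph is its number of vertices. A set $S\subseteq V(G)$ is a dominating set of $G$ if every vertex of $V(G)\setminus S$ has at least one neighbor in $S$. Two disjoint sets $V_1,V_2\subseteq V(G)$ form a coalition if neither $V_1$ nor $V_2$ is a dominating set of $G$ but $V_1\cup V_2$ is a dominating set of $G$. A coalition partition (c-partition) of $G$ is a partition $\pi=\{V_1,\dots,V_k\}$ of $V(G)$ into nonempty sets such that every $V_i\in\pi$ is either a singleton dominating set of $G$, or is not a dominating set of $G$ but forms a coalition with another non-dominating set $V_j\in\pi$. The coalition number $C(G)$ is the maximum $k$ such that $G$ has a c-partition with $k$ sets. *)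

(* Defs.v *)
From mathcomp Require Import all_boot.

Set Implicit Arguments.
Unset Strict Implicit.
Unset Printing Implicit Defensive.

Record sgraph := SGraph {
  vertex :> finType;
  adj : rel vertex;
  adj_sym : symmetric adj;
  adj_irr : irreflexive adj }.

Definition graph_order (G : sgraph) : nat := #|G|.

Definition degree (G : sgraph) (x : G) : nat := #|[set y | adj x y]|.

Definition cubic (G : sgraph) : Prop := forall x : G, degree x = 3.

Definition isomorphic (G H : sgraph) : Prop :=
  exists2 f : G -> H, bijective f & {mono f : x y / adj x y}.

Definition complete_adj (n : nat) : rel 'I_n := [rel x y | x != y].

Fact complete_sym n : symmetric (@complete_adj n).
Proof. by move=> x y; rewrite /complete_adj /= eq_sym. Qed.

Fact complete_irr n : irreflexive (@complete_adj n).
Proof. by move=> x; rewrite /complete_adj /= eqxx. Qed.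

Definition complete (n : nat) : sgraph :=
  SGraph (@complete_sym n) (@complete_irr n).

Definition bipartite_adj (m n : nat) : rel ('I_m + 'I_n) :=
  fun x y =>
    match x, y with
    | inl _, inr _ | inr _, inl _ => true
    | _, _ => false
    end.

Fact bipartite_sym m n : symmetric (@bipartite_adj m n).
Proof. by case=> x [] y. Qed.

Fact bipartite_irr m n : irreflexive (@bipartite_adj m n).
Proof. by case. Qed.

Definition complete_bipartite (m n : nat) : sgraph :=
  SGraph (@bipartite_sym m n) (@bipartite_irr m n).

Section Product.

Variables G H : sgraph.

Definition box_adj : rel (G * H) :=
  [rel x y | (adj x.1 y.1 && (x.2 == y.2)) || ((x.1 == y.1) && adj x.2 y.2)].

Fact box_sym : symmetric box_adj.
Proof.
move=> x y; rewrite /box_adj /= (adj_sym x.1) (adj_sym x.2).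
by rewrite (eq_sym x.1) (eq_sym x.2).
Qed.

Fact box_irr : irreflexive box_adj.
Proof. by move=> x; rewrite /box_adj /= !adj_irr andbF. Qed.

Definition cartesian_product : sgraph := SGraph box_sym box_irr.

End Product.

Section Coalitions.

Variable G : sgraph.
Implicit Types (A B S : {set G}) (P : {set {set G}}).

Definition dominating S : bool :=
  [forall x in ~: S, exists y in S, adj x y].

Definition coalition A B : bool :=
  [&& [disjoint A & B], ~~ dominating A, ~~ dominating B &
      dominating (A :|: B)].

Definition c_partition P : bool :=
  partition P [set: G] &&
  [forall A in P,
     ((#|A| == 1) && dominating A) ||
     (~~ dominating A &&
      [exists B in P, [&& B != A, ~~ dominating B & coalition A B]])].

End Coalitions.

(* The maximum over an empty family is 0; a value k > 0 is always attained
   by an actual c-partition. *)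
Definition coalition_number (G : sgraph) : nat :=
  \max_(P : {set {set G}} | c_partition P) #|P|.

(* Main.v *)
(** A cubic graph of order 6 without triangles is K_{3,3}: the neighbourhood
    N of a vertex has 3 elements, and each of them must be adjacent to all
    3 vertices outside N.  If there is a triangle T, every vertex of T has
    exactly one neighbour outside T, while every vertex outside T has at least
    one neighbour in T, because only two other vertices lie outside T.  By
    counting, the edges leaving T form a perfect matching, so the complement
    of T is a triangle as well and the graph is the prism.

    The partition into singletons is a c-partition as soon as no vertex
    dominates the graph and every vertex belongs to a dominating pair: take
    two vertices on opposite sides of K_{3,3}, or the two ends of a matching
    edge of the prism. *)

Require Import Defs.
From mathcomp Require Import all_boot.

Set Implicit Arguments.
Unset Strict Implicit.
Unset Printing Implicit Defensive.

(** Equal orders make [f] bijective, and it sends the neighbours of [x] injectively to neighbours of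
    [f x]. As the degrees agree, these are all the neighbours of [f x], so non-edges are preserved
    too. Below, [f] runs from an explicit graph into [G], and only edges have to be checked. *)
Lemma isomorphic_of_inj_hom (G H : sgraph) (f : H -> G) :
    injective f -> {homo f : x y / adj x y} ->
    (forall x, degree (f x) = degree x) -> #|G| = #|H| ->
  isomorphic G H.
Proof.
move=> f_inj f_hom f_deg eqGH.
have [g fK gK] : bijective f by apply: inj_card_bij; rewrite ?eqGH.
exists g; first by exists f.
move=> u v; rewrite -{2}(gK u) -{2}(gK v); move: (g u) (g v) => x y.
have /eqP NfE : f @: [set z | adj x z] == [set z | adj (f x) z].
  rewrite eqEcard (card_imset _ f_inj) -/(degree x) -/(degree (f x)) f_deg.
  rewrite leqnn andbT; apply/subsetP => _ /imsetP[z + ->].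
  by rewrite !inE => /f_hom.
by move/setP/(_ (f y)): NfE; rewrite mem_imset // !inE.
Qed.

(** * Degrees in the explicit graphs, and their non-isomorphism *)

Lemma degree_complete_bipartite (m n : nat) (x : complete_bipartite m n) :
  degree x = if x is inl _ then n else m.
Proof.
case: x => i; rewrite /degree.
- rewrite -[RHS](card_ord n) -cardsT -(card_imset _ (@inr_inj 'I_m 'I_n)).
  apply: eq_card => -[j|j]; rewrite !inE /=.
  + by symmetry; apply/imsetP => -[].
  + by symmetry; apply: imset_f.
- rewrite -[RHS](card_ord m) -cardsT -(card_imset _ (@inl_inj 'I_m 'I_n)).
  apply: eq_card => -[j|j]; rewrite !inE /=.
  + by symmetry; apply: imset_f.
  + by symmetry; apply/imsetP => -[].
Qed.

Lemma degree_complete (n : nat) (x : complete n) : degree x = n.-1.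
Proof.
rewrite -[in RHS](card_ord n) -(cardsC1 x).
by apply: eq_card => y; rewrite !inE eq_sym.
Qed.

Lemma degree_cartesian_product (G H : sgraph) (u : cartesian_product G H) :
  degree u = degree u.1 + degree u.2.
Proof.
case: u => x y; rewrite /degree /=.
(* The neighbourhood of [(x, y)] is the union of N(x) × {y} and {x} × N(y), which are disjoint
   because [x] is not in N(x). *)
rewrite -[in RHS](muln1 #|[set z | adj x z]|) -(cards1 y) -cardsX.
rewrite -[#|[set z | adj y z]|]mul1n -(cards1 x) -cardsX -cardsUI.
rewrite [X in _ = _ + X]eq_card0 => [|[z w]]; last first.
  rewrite !inE /=; case: (eqVneq z x) => [->|]; last by rewrite andbF.
  by rewrite adj_irr.
rewrite addn0; apply: eq_card => -[z w].
by rewrite !inE /= /box_adj /= (eq_sym y) (eq_sym x).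
Qed.

Lemma K33_cubic : cubic (complete_bipartite 3 3).
Proof. by move=> x; rewrite degree_complete_bipartite; case: x. Qed.

Lemma K33_order : graph_order (complete_bipartite 3 3) = 6.
Proof. by rewrite /graph_order /= card_sum !card_ord. Qed.

Lemma prism_cubic : cubic (cartesian_product (complete 3) (complete 2)).
Proof. by move=> u; rewrite degree_cartesian_product !degree_complete. Qed.

Lemma prism_order :
  graph_order (cartesian_product (complete 3) (complete 2)) = 6.
Proof. by rewrite /graph_order /= card_prod !card_ord. Qed.

Lemma K33_not_prism :
  ~ isomorphic (complete_bipartite 3 3)
      (cartesian_product (complete 3) (complete 2)).
Proof.
case=> f [g fK gK] f_mono.
(* One layer of the prism is a triangle. Its preimage would be a triangle in the bipartite graph,
   where two of three vertices share a side. *)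
pose v (i : 'I_3) : cartesian_product (complete 3) (complete 2) := (i, ord0).
have tri i j : i != j -> adj (g (v i)) (g (v j)).
  by move=> neq_ij; rewrite -f_mono !gK /= /box_adj /= /complete_adj /= neq_ij.
have := tri ord0 (inord 1); have := tri (inord 1) ord_max.
have := tri ord0 ord_max; rewrite -!val_eqE /= !inordK //=.
by case: (g _) (g (v (inord 1))) (g (v ord_max))
  => ? [] ? [] ? // /(_ isT) ? /(_ isT) ? /(_ isT).
Qed.

(** * Classification of the cubic graphs of order 6 *)

Section CubicOrder6.

Variable G : sgraph.
Hypotheses (G_cubic : cubic G) (G_order : graph_order G = 6).

Lemma triangle_free_K33 :
    (forall x y z : G, adj x y -> adj y z -> ~~ adj x z) ->
  isomorphic G (complete_bipartite 3 3).
Proof.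
move=> tri_free.
have /card_gt0P[x _] : 0 < #|G| by rewrite -/(graph_order G) G_order.
pose N := [set y | adj x y].
have cardN : #|N| = 3 := G_cubic x.
have cardNC : #|~: N| = 3.
  by apply: (@addnI #|N|); rewrite cardsC -/(graph_order G) G_order cardN.
have NadjNC a b : a \in N -> b \in ~: N -> adj a b.
  (* A neighbour of [a] inside [N] would close a triangle with [x]. So the three neighbours of [a]
     lie in [~: N], which has just three elements. *)
  move=> aN bN; have /eqP NaE : [set y | adj a y] == ~: N.
    rewrite eqEcard -/(degree a) G_cubic cardNC leqnn andbT.
    by apply/subsetP=> y; move: aN; rewrite !inE => /tri_free; apply.
  by move: bN; rewrite -NaE inE.
pose f (u : 'I_3 + 'I_3) : G := match u with
  | inl i => enum_val (cast_ord (esym cardN) i)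
  | inr i => enum_val (cast_ord (esym cardNC) i) end.
have fl i : f (inl i) \in N by apply: enum_valP.
have fr i : f (inr i) \in ~: N by apply: enum_valP.
apply: (@isomorphic_of_inj_hom _ (complete_bipartite 3 3) f).
- move=> [] i [] j eq_f.
  + by congr inl; apply: (cast_ord_inj (enum_val_inj eq_f)).
  + by have := fr j; rewrite -eq_f inE fl.
  + by have := fr i; rewrite eq_f inE fl.
  + by congr inr; apply: (cast_ord_inj (enum_val_inj eq_f)).
- move=> [] i [] j //= _.
  + by apply: NadjNC; [apply: fl | apply: fr].
  + by rewrite adj_sym; apply: NadjNC; [apply: fl | apply: fr].
- by move=> u; rewrite G_cubic K33_cubic.
- by rewrite -!/(graph_order _) G_order K33_order.
Qed.

Lemma triangle_prism (t : 'I_3 -> G) :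
    (forall i j, i != j -> adj (t i) (t j)) ->
  isomorphic G (cartesian_product (complete 3) (complete 2)).
Proof.
move=> tri.
have t_inj : injective t.
  move=> i j eq_t; apply: contraTeq isT => /tri.
  by rewrite eq_t adj_irr.
pose T := t @: 'I_3.
have cardT : #|T| = 3 by rewrite card_imset ?card_ord.
have cardTC : #|~: T| = 3.
  by apply: (@addnI #|T|); rewrite cardsC -/(graph_order G) G_order cardT.
have NT i : [set y | adj (t i) y] :&: T = T :\ t i.
  apply/setP=> y; rewrite !inE andbC [RHS]andbC.
  case: imsetP => //= -[j _ ->]; rewrite (inj_eq t_inj).
  by case: (eqVneq j i) => [->|neq_ji]; rewrite ?adj_irr // tri // eq_sym.
have cardTD i : #|T :\ t i| = 2.
  by apply: (@addnI 1); rewrite -[RHS]cardT (cardsD1 (t i) T) imset_f.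
have cardN y : #|[set z | adj y z] :&: T| + #|[set z | adj y z] :\: T| = 3.
  by rewrite cardsID; apply: G_cubic.
have cardNTC i : #|[set y | adj (t i) y] :\: T| == 1.
  by rewrite -(eqn_add2l 2) -{1}(cardTD i) -NT cardN.
(* [p i] is the unique neighbour of [t i] outside the triangle, the other end of its matching
   edge. *)
have /fin_all_exists[p pP] i : exists y, [set z | adj (t i) z] :\: T = [set y].
  exact/cards1P.
have pE i y : y \notin T -> adj (t i) y = (y == p i).
  by move=> yT; move/setP/(_ y): (pP i); rewrite !inE yT.
have pT i : p i \notin T.
  by move/setP/(_ (p i)): (pP i); rewrite !inE eqxx => /andP[].
have cardTCD y : y \notin T -> #|~: T :\ y| = 2.
  by move=> yT; apply: (@addnI 1); rewrite -[RHS]cardTC (cardsD1 y (~: T)) inE yT.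
have NTCsub y : [set z | adj y z] :\: T \subset ~: T :\ y.
  apply/subsetP=> z; rewrite !inE => /andP[-> yz]; rewrite andbT.
  by apply: contraTneq yz => ->; rewrite adj_irr.
have p_surj y : y \notin T -> exists i, y = p i.
  move=> yT; have /subset_leq_card := NTCsub y; rewrite cardTCD // => le2.
  have : 0 < #|[set z | adj y z] :&: T|.
    by rewrite -(ltn_add2r #|[set z | adj y z] :\: T|) cardN.
  case/card_gt0P=> z; rewrite !inE => /andP[yz /imsetP[i _ zE]].
  by move: yz; rewrite zE adj_sym pE // => /eqP ->; exists i.
(* The image of [p] covers the three vertices of [~: T], so the three values of [p] are distinct. *)
have p_inj : injective p.
  apply/injectiveP/(@dinjectiveP _ _ p 'I_3)/imset_injP.
  rewrite eqn_leq leq_imset_card card_ord /= -[X in X <= _]cardTC subset_leq_card //.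
  by apply/subsetP=> y; rewrite inE => /p_surj[i ->]; apply: imset_f.
have adj_p i j : i != j -> adj (p i) (p j).
  move=> neq_ij.
  (* By injectivity of [p], the only neighbour of [p i] in [T] is [t i]. Its other two neighbours
     then exhaust [~: T :\ p i]. *)
  have NpT : [set z | adj (p i) z] :&: T = [set t i].
    apply/setP=> z; rewrite !inE andbC; case: imsetP => [[k _ ->]|zT] /=.
      by rewrite adj_sym pE // !(inj_eq p_inj) (inj_eq t_inj) eq_sym.
    by symmetry; apply/eqP => zE; case: zT; exists i.
  have /eqP/setP/(_ (p j)) : [set z | adj (p i) z] :\: T == ~: T :\ p i.
    rewrite eqEcard NTCsub cardTCD //=.
    by have := cardN (p i); rewrite NpT cards1 => /(@addnI 1 _ 2) ->.
  by rewrite !inE pT (inj_eq p_inj) eq_sym neq_ij.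
(* Layer 0 of the prism goes to the given triangle, layer 1 to the matched vertices. *)
pose f (u : 'I_3 * 'I_2) : G := if u.2 == ord0 then t u.1 else p u.1.
have tNp i j : t i <> p j by move=> eq_tp; have := pT j; rewrite -eq_tp imset_f.
apply: (@isomorphic_of_inj_hom _
  (cartesian_product (complete 3) (complete 2)) f).
- move=> [i [[|[|//]] ?]] [j [[|[|//]] ?]]; rewrite /f /= => eq_f.
  + by rewrite (t_inj _ _ eq_f); congr pair; apply: val_inj.
  + by have := tNp _ _ eq_f.
  + by have := tNp _ _ (esym eq_f).
  + by rewrite (p_inj _ _ eq_f); congr pair; apply: val_inj.
- move=> [i [[|[|//]] ?]] [j [[|[|//]] ?]];
    rewrite /f /= /box_adj /= /complete_adj /= -!val_eqE /= ?andbT ?andbF ?orbF //.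
  + exact: tri.
  + by move/eqP/val_inj->; rewrite pE.
  + by move/eqP/val_inj->; rewrite adj_sym pE.
  + exact: adj_p.
- by move=> u; rewrite G_cubic prism_cubic.
- by rewrite -!/(graph_order _) G_order prism_order.
Qed.

End CubicOrder6.

(** * Coalition numbers *)

Lemma leq_card_partition (T : finType) (P : {set {set T}}) (D : {set T}) :
  partition P D -> #|P| <= #|D|.
Proof.
move=> partP; rewrite (card_partition partP) -sum1_card leq_sum // => A AP.
by rewrite card_gt0 (partition_neq0 partP).
Qed.

Lemma coalition_number_order (G : sgraph) :
    (forall x : G, ~~ dominating [set x]) ->
    (forall x : G, exists2 y, y != x & dominating [set x; y]) ->
  coalition_number G = graph_order G.
Proof.
move=> ndom1 dom2; apply/eqP; rewrite eqn_leq; apply/andP; split.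
  (* Parts are nonempty, so no partition has more parts than there are vertices. *)
  apply/bigmax_leqP => P /andP[/leq_card_partition + _].
  by rewrite cardsT.
pose P := [set [set x] | x : G].
have cardP : #|P| = graph_order G by rewrite card_imset //; apply: set1_inj.
rewrite -cardP; apply: (leq_bigmax_cond (P := @c_partition G)).
apply/andP; split.
  apply/and3P; split.
  - rewrite eqEsubset subsetT; apply/subsetP=> x _.
    by apply/bigcupP; exists [set x]; rewrite ?set11 ?imset_f.
  - apply/trivIsetP=> _ _ /imsetP[x _ ->] /imsetP[y _ ->] neq_xy.
    by rewrite disjoints1 inE; apply: contraNneq neq_xy => ->.
  - apply/negP => /imsetP[x _ /setP/(_ x)]; by rewrite !inE eqxx.
apply/forall_inP=> _ /imsetP[x _ ->]; rewrite ndom1 /=; apply/orP; right.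
have [y neq_yx domxy] := dom2 x; apply/exists_inP; exists [set y].
  exact: imset_f.
rewrite /coalition !ndom1 domxy disjoints1 inE (inj_eq set1_inj).
by rewrite neq_yx eq_sym neq_yx.
Qed.

Lemma dominating1_order (G : sgraph) (x : G) :
  dominating [set x] -> graph_order G <= (degree x).+1.
Proof.
move/forall_inP => domx.
rewrite /graph_order -cardsT (cardsD1 x) inE ltnS subset_leq_card //.
apply/subsetP=> y; rewrite !inE andbT => neq_yx.
have /exists_inP[z] : [exists z in [set x], adj y z].
  by apply: domx; rewrite !inE.
by rewrite !inE adj_sym => /eqP ->.
Qed.

Lemma dominating2 (G : sgraph) (x y : G) :
  (forall z, [|| z == x, z == y, adj z x | adj z y]) -> dominating [set x; y].
Proof.
move=> cover; apply/forall_inP=> z; rewrite !inE negb_or => /andP[zx zy].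
have := cover z; rewrite (negPf zx) (negPf zy) /= => /orP[] adjz.
- by apply/exists_inP; exists x; rewrite ?set21.
- by apply/exists_inP; exists y; rewrite ?set22.
Qed.

Lemma cubic6_coalition_number (G : sgraph) :
    cubic G -> graph_order G = 6 ->
    (forall x : G, exists2 y, y != x &
       forall z, [|| z == x, z == y, adj z x | adj z y]) ->
  coalition_number G = 6.
Proof.
move=> G_cubic G_order dom2; rewrite -G_order.
apply: coalition_number_order => x; last first.
  by have [y neq_yx /dominating2] := dom2 x; exists y.
(* In a cubic graph a single vertex dominates at most 1 + 3 = 4 vertices, fewer than 6. *)
by apply/negP => /dominating1_order; rewrite G_order G_cubic.
Qed.

Theorem theorem2p5 :
  let K33 := complete_bipartite 3 3 in
  let prism := cartesian_product (complete 3) (complete 2) in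
  [/\ cubic K33 /\ graph_order K33 = 6,
      cubic prism /\ graph_order prism = 6,
      ~ isomorphic K33 prism,
      forall G : sgraph, cubic G -> graph_order G = 6 ->
        isomorphic G K33 \/ isomorphic G prism
    & coalition_number K33 = 6 /\ coalition_number prism = 6].
Proof.
move=> K33 prism; split.
- by split; [apply: K33_cubic | apply: K33_order].
- by split; [apply: prism_cubic | apply: prism_order].
- exact: K33_not_prism.
- move=> G G_cubic G_order.
  have [/existsP[x /existsP[y /existsP[z /and3P[xy yz xz]]]]|tri_free] :=
    boolP [exists x : G, exists y, exists z, [&& adj x y, adj y z & adj x z]].
    (* The nine index pairs reduce to the three edges found and their reversals, whence
       [adj_sym]. *)
    right; apply: (triangle_prism G_cubic G_order (t := tnth [tuple x; y; z])).
    by move=> [[|[|[|//]]] ?] [[|[|[|//]]] ?] //= _;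
      rewrite /tnth //= adj_sym.
  left; apply: triangle_free_K33 => // x y z xy yz.
  apply: contra tri_free => xz.
  by apply/existsP; exists x; apply/existsP; exists y; apply/existsP; exists z;
    rewrite xy yz.
- split.
  + apply: (cubic6_coalition_number K33_cubic K33_order).
    case=> x; [exists (inr ord0) | exists (inl ord0)] => //;
      by case=> z; rewrite ?orbT.
  + apply: (cubic6_coalition_number prism_cubic prism_order) => -[i a].
    (* On ['I_2], [rev_ord] swaps the two layers. Each layer is a triangle containing one of the two
       chosen vertices, which dominates it. *)
    exists (i, rev_ord a).
      by case: a => [[|[|//]] ?]; rewrite xpair_eqE -!val_eqE andbF.
    case=> j b; rewrite /= /box_adj /= /complete_adj /= !xpair_eqE.
    by case: eqVneq => //= _; case: a b => [[|[|//]] ?] [[|[|//]] ?].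
Qed.
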